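(* Let $G$ be a Hausdorff topological group, $\theta$ a nice partial action of $G$ on a topological space $Y$, and $X$ a nonempty compact metrizable space, with $\hat\theta$ the induced partial action on $C(X,Y)$ (compact-open topology). Then the following are equivalent: (i) $Y$ is an ANE; (ii) $Y_G$ is an ANE; (iii) $C(X,Y)_G$ is an ANE; (iv) $C(X,Y)$ is an ANE.
   Context: A topological partial action of $G$ on $Y$ is a family of homeomorphisms $\theta_g\colon Y_{g^{-1}}\to Y_g$ between open subsets with $Y_e=Y$, $\theta_e=\mathrm{id}_Y$, $\theta_{g^{-1}}=\theta_g^{-1}$, $\theta_g\circ\theta_h$ a restriction of $\theta_{gh}$; it is nice if $G*Y=\{(g,y): y\in Y_{g^{-1}}\}$ is open in $G\times Y$ and $(g,y)\mapsto\theta_g(y)$ is continuous on $G*Y$. $\hat\theta$ has $C(X,Y)_g=\{f: f(X)\subset Y_g\}$ and $\hat\theta_g(f)=\theta_g\circ f$. For a topological partial action on $W$, the enveloping space is $W_G=(G\times W)/R$ with the quotient topology, where $(g,x)R(h,y)$ iff $x\in W_{g^{-1}h}$ and $\theta_{h^{-1}g}(x)=y$. A space $W$ is an ANE (absolute neighborhood extensor) if for every metrizable space $Z$, every closed $A\subset Z$ and every continuous $f\colon A\to W$ there is a continuous extension of $f$ to some neighborhood of $A$ in $Z$. *)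

(* Defs.v *)
From HB Require Import structures.
From mathcomp Require Import all_boot all_order all_algebra.
From mathcomp Require Import all_classical all_reals topology.
From Stdlib Require Import Rdefinitions Raxioms.

Set Implicit Arguments.
Unset Strict Implicit.
Unset Printing Implicit Defensive.

Local Open Scope classical_set_scope.

Definition metrizable (Z : topologicalType) : Prop :=
  exists d : Z -> Z -> Rdefinitions.R,
    [/\ (forall x y, Rle R0 (d x y)),
        (forall x y, d x y = R0 <-> x = y),
        (forall x y, d x y = d y x),
        (forall x y z, Rle (d x z) (Rplus (d x y) (d y z))) &
        (forall U : set Z, open U <->
           (forall x, U x -> exists e, Rlt R0 e /\
              (forall y, Rlt (d x y) e -> U y)))].

(* Absolute neighborhood extensors.  Subsets of a space carry the      *)
(* subspace topology (set_type with the initial topology of set_val).  *)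
Definition ANE (W : topologicalType) : Prop :=
  forall (Z : topologicalType), metrizable Z ->
  forall (A : set Z), closed A ->
  forall (f : set_type A -> W), continuous f ->
  exists (U : set Z), A `<=` interior U /\
    exists F : set_type U -> W, continuous F /\
      (forall (u : set_type U) (a : set_type A), val u = val a -> F u = f a).

Definition topological_group (G : topologicalType)
    (mul : G -> G -> G) (inv : G -> G) (one : G) : Prop :=
  [/\ (forall x y z, mul x (mul y z) = mul (mul x y) z),
      (forall x, mul one x = x /\ mul x one = x),
      (forall x, mul (inv x) x = one /\ mul x (inv x) = one),
      continuous (fun p : G * G => mul p.1 p.2) &
      continuous inv].

(* Topological partial action: theta g is (the restriction to the open *)
(* set D (inv g) of) a homeomorphism D (inv g) -> D g.                 *)
Definition partial_action (G : topologicalType)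
    (mul : G -> G -> G) (inv : G -> G) (one : G)
    (Y : topologicalType) (D : G -> set Y) (theta : G -> Y -> Y) : Prop :=
  [/\ (forall g, open (D g)),
      D one = setT /\ (forall y, theta one y = y),
      (forall g y, D (inv g) y -> D g (theta g y) /\ theta (inv g) (theta g y) = y),
      (* continuity of theta g on D (inv g); applied to inv g this gives *)
      (* continuity of the inverse, hence homeomorphisms *)
      (forall g, {within D (inv g), continuous (theta g)}) &
      (forall g h y, D (inv h) y -> D (inv g) (theta h y) ->
         D (inv (mul g h)) y /\ theta (mul g h) y = theta g (theta h y))].

Definition nice_partial_action (G : topologicalType)
    (mul : G -> G -> G) (inv : G -> G) (one : G)
    (Y : topologicalType) (D : G -> set Y) (theta : G -> Y -> Y) : Prop :=
  [/\ partial_action mul inv one D theta,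
      open [set p : G * Y | D (inv p.1) p.2] &
      {within [set p : G * Y | D (inv p.1) p.2],
         continuous (fun p : G * Y => theta p.1 p.2)}].

Definition CXY (X Y : topologicalType) : topologicalType :=
  set_type [set f : {compact-open, X -> Y} | continuous (f : X -> Y)].

Section hat.
Context {G X Y : topologicalType} (D : G -> set Y) (theta : G -> Y -> Y).

Definition hat_dom (g : G) : set (CXY X Y) :=
  [set f | forall x, D g ((val f : X -> Y) x)].

(* hat theta g f = theta g \o f  (the fallback branch, used only when    *)
(* theta g \o f is not continuous, never matters on C(X,Y)_{g^-1}).     *)
Definition hat_act (g : G) (f : CXY X Y) : CXY X Y :=
  match pselect (continuous (theta g \o (val f : X -> Y))) with
  | left H => @SigSub _ _ [set f : {compact-open, X -> Y} | continuous (f : X -> Y)]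
                (theta g \o (val f : X -> Y)) (mem_set H)
  | right _ => f
  end.
End hat.

Definition env_rel (G W : Type) (mul : G -> G -> G) (inv : G -> G)
    (D : G -> set W) (theta : G -> W -> W) (p q : G * W) : Prop :=
  D (mul (inv p.1) q.1) p.2 /\ theta (mul (inv q.1) p.1) p.2 = q.2.

Section envelope.
Context {G W : topologicalType} (R : G * W -> G * W -> Prop).

Definition envelope : Type := {S : set (G * W) | exists p, S = R p}.

Definition env_pi (p : G * W) : envelope := exist _ (R p) (ex_intro _ p erefl).

HB.instance Definition _ := gen_eqMixin envelope.
HB.instance Definition _ := gen_choiceMixin envelope.

Definition env_open (U : set envelope) : Prop := open (env_pi @^-1` U).

Program Definition env_topology_mixin :=
  @isOpenTopological.Build envelope env_open _ _ _.
Next Obligation. by rewrite /env_open preimage_setT; exact: openT. Qed.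
Next Obligation. by move=> ? ? ? ?; exact: openI. Qed.
Next Obligation. by move=> I f ofi; apply: bigcup_open => i _; exact: ofi. Qed.
HB.instance Definition _ := env_topology_mixin.
End envelope.

Definition enveloping_space (G W : topologicalType) (mul : G -> G -> G)
    (inv : G -> G) (D : G -> set W) (theta : G -> W -> W) : topologicalType :=
  envelope (env_rel mul inv D theta).

(* Main.v *)
(** The enveloping space is covered by the sets [g Y], and for a nice partial
    action each of them is open and homeomorphic to [Y].  So [Y] inherits the
    extension property from [Y_G] as an open subspace, and conversely [Y_G] has
    it by Hanner's theorem, that a union of open ANEs is an ANE.  For a map [f]
    from a closed [A] into such a union, take a locally finite closed cover
    [K j] of the metrizable space whose traces on [A] are mapped by [f] into
    single members [V j] of the union; [f] is then extended over a neighborhood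
    of [A `&` K j] in [K j], one [j] at a time, keeping at every step the
    condition that [K k] is mapped into [V k] for all [k].

    Compactness of [X] makes the induced partial action on [C(X, Y)] nice, so
    the same applies to it.  Finally [Y] is a retract of [C(X, Y)] (constants
    and an evaluation), while a map from [A] to [C(X, Y)] is a map from [A * X]
    to [Y], and a neighborhood of [A * X] contains some [U * X]. *)

From Stdlib Require Import Rdefinitions RIneq Rbasic_fun Rfunctions Lra.
Require Import Defs.
From mathcomp Require Import all_boot all_order all_algebra.
From mathcomp Require Import all_classical all_reals topology wochoice.

Set Implicit Arguments.
Unset Strict Implicit.
Unset Printing Implicit Defensive.

Local Open Scope classical_set_scope.

(** * Metrizable spaces *)

Definition metric_of (Z : topologicalType) (d : Z -> Z -> R) : Prop :=
  [/\ (forall x y, Rle R0 (d x y)),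
      (forall x y, d x y = R0 <-> x = y),
      (forall x y, d x y = d y x),
      (forall x y z, Rle (d x z) (Rplus (d x y) (d y z))) &
      (forall U : set Z, open U <->
         (forall x, U x -> exists e, Rlt R0 e /\
            (forall y, Rlt (d x y) e -> U y)))].

Section metric.
Local Open Scope R_scope.
Context (Z : topologicalType) (d : Z -> Z -> R) (dP : metric_of d).

Let dxx x : d x x = 0. Proof. by case: dP => _ d0 _ _ _; apply/d0. Qed.
Let dC x y : d x y = d y x. Proof. by case: dP. Qed.
Let dT y x z : d x z <= d x y + d y z. Proof. by case: dP. Qed.

Lemma metric_ball_open x e : open [set y | d x y < e].
Proof.
case: dP => _ _ _ _ /(_ [set y | d x y < e]) [_]; apply => y /= xy.
exists (e - d x y); split; first lra.
move=> z yz; have := dT y x z; lra.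
Qed.

Lemma metric_ball_nbhs x e : 0 < e -> nbhs x [set y | d x y < e].
Proof.
move=> e0; apply: open_nbhs_nbhs; split; first exact: metric_ball_open.
by rewrite /= dxx.
Qed.

Lemma nbhs_metricP x (N : set Z) :
  nbhs x N <-> exists e, 0 < e /\ forall y, d x y < e -> N y.
Proof.
split=> [|[e [e0 eN]]].
  rewrite nbhsE => -[O [oO Ox] ON].
  case: dP => _ _ _ _ /(_ O) [/(_ oO x Ox) [e [e0 eO]] _].
  by exists e; split=> // y /eO /ON.
by apply: filterS (metric_ball_nbhs x e0) => y /eN.
Qed.

(** [inner] is a union of balls around points of [A] whose doubles lie in [O], [outer] a union of
    balls around points outside [O] whose doubles miss [A]. They are disjoint: at a common point,
    the double of the larger ball would contain the centre of the other. [H] is the complement of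
    [outer]. *)
Lemma metric_closed_nbhs (A O : set Z) : closed A -> open O -> A `<=` O ->
  exists H, [/\ closed H, A `<=` interior H & H `<=` O].
Proof.
move=> cA oO AO.
pose inner : set Z := [set z | exists x r, [/\ A x, 0 < r,
  (forall y, d x y < 2 * r -> O y) & d x z < r]].
pose outer : set Z := [set z | exists x r, [/\ ~ O x, 0 < r,
  (forall y, d x y < 2 * r -> ~ A y) & d x z < r]].
have oball (P : Z -> R -> Prop) :
    open [set z | exists x r, P x r /\ d x z < r].
  rewrite (_ : mkset _ = \bigcup_(p in [set p : Z * R | P p.1 p.2])
                           [set z | d p.1 z < p.2]).
    by apply: bigcup_open => p _; exact: metric_ball_open.
  apply/seteqP; split=> [z [x [r [Pxr xz]]]|z [[x r] /= Pxr xz]].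
    by exists (x, r).
  by exists x, r.
have oouter : open outer.
  have := oball (fun x r => [/\ ~ O x, 0 < r &
    (forall y, d x y < 2 * r -> ~ A y)]).
  congr open; apply/seteqP; split=> z [x [r]].
    by move=> [[? ? ?] ?]; exists x, r.
  by move=> [? ? ? ?]; exists x, r.
have oinner : open inner.
  have := oball (fun x r => [/\ A x, 0 < r &
    (forall y, d x y < 2 * r -> O y)]).
  congr open; apply/seteqP; split=> z [x [r]].
    by move=> [[? ? ?] ?]; exists x, r.
  by move=> [? ? ? ?]; exists x, r.
have half x (N : set Z) : nbhs x N ->
    exists r, 0 < r /\ forall y, d x y < 2 * r -> N y.
  move=> /nbhs_metricP [e [e0 eN]]; exists (e / 2); split; first lra.
  by move=> y xy; apply: eN; lra.
exists (~` outer); split.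
- exact: open_closedC.
- move=> x Ax.
  have innerx : inner x.
    have [r [r0 rO]] := half x O (open_nbhs_nbhs (conj oO (AO _ Ax))).
    by exists x, r; split=> //; rewrite dxx.
  apply: filterS (open_nbhs_nbhs (conj oinner innerx)) => z.
  move=> [y [r [Ay r0 rO yz]]] [y' [r' [nOy' r'0 r'A y'z]]].
  have yy' : d y y' < r + r' by have := dT z y y'; have := dC z y'; lra.
  case: (Rle_lt_dec r' r) => rr'.
    by apply: nOy'; apply: rO; lra.
  by apply: (r'A y) => //; rewrite dC; lra.
- move=> z nz; apply: contrapT => nOz; apply: nz.
  have nAz : nbhs z (~` A).
    by apply: open_nbhs_nbhs; split; [exact: closed_openC | move=> /AO].
  have [r [r0 rA]] := half z _ nAz.
  by exists z, r; split=> //; rewrite dxx.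
Qed.

(* M. E. Rudin's construction.  A point outside the earlier layers is assigned
   to the first member of the cover containing it, in a well-order of the
   indices; since that member also contains the ball of radius [3 * 2^-n], sets
   of layer [n] with distinct indices are at distance at least [2^-n]. *)
Section refinement.
Context (I : choiceType) (C : I -> set Z).
Context (oC : forall i, open (C i)) (coverC : forall z, exists i, C i z).
Context (le : rel I) (le_wo : well_order le).

Let first_of b x := C b x /\ forall c, C c x -> le b c.

Let first_exists x : exists b, first_of b x.
Proof.
have [i Cix] := coverC x.
have [|b [[Cb lb] _]] := le_wo (A := [pred i | `[< C i x >]]).
  by exists i; exact/asboolP.
exists b; split; first exact/asboolP.
by move=> c Cc; apply: lb; exact/asboolP.
Qed.

Let rad n := (/ 2) ^ n.

Let rad_gt0 n : 0 < rad n.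
Proof. by apply: pow_lt; lra. Qed.

Let radS n : rad n.+1 = rad n / 2.
Proof. by rewrite /rad /=; lra. Qed.

Let rad_le m n : (m <= n)%N -> rad n <= rad m.
Proof.
move=> /subnK <-; elim: (n - m)%N => [|k IH]; first by rewrite add0n; lra.
by rewrite addSn radS; have := rad_gt0 (k + m); lra.
Qed.

Let rad_lt e : 0 < e -> exists n, rad n < e.
Proof.
move=> e0; have [|N /(_ N) HN] := pow_lt_1_zero (/ 2) _ e e0.
  by rewrite Rabs_pos_eq; lra.
exists N; have := HN (le_n _); rewrite Rabs_pos_eq //.
exact/Rlt_le/rad_gt0.
Qed.

(** [P] stands for the union of the earlier layers; as a parameter it lets [rudin_union] recurse on
    [n]. Only the centres avoid [P]: the balls around them may meet it. *)
Definition rudin_layer n (P : set Z) b : set Z :=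
  [set z | exists x, [/\ first_of b x, ~ P x,
     (forall y, d x y < 3 * rad n -> C b y) & d x z < rad n]].

Fixpoint rudin_union n : set Z :=
  if n is m.+1 then
    rudin_union m `|` \bigcup_b rudin_layer m (rudin_union m) b
  else set0.

Let D n b := rudin_layer n (rudin_union n) b.

Let D_open n b : open (D n b).
Proof.
rewrite (_ : D n b = \bigcup_(x in [set x | [/\ first_of b x,
   ~ rudin_union n x & forall y, d x y < 3 * rad n -> C b y]])
   [set z | d x z < rad n]).
  by apply: bigcup_open => x _; exact: metric_ball_open.
apply/seteqP; split=> [z [x [? ? ? ?]]|z [x [? ? ?] ?]]; first by exists x.
by exists x.
Qed.

Let D_sub_union m n b : (m < n)%N -> D m b `<=` rudin_union n.
Proof.
move=> /subnK <- z Dz; elim: (n - m.+1)%N => [|k IH]; first by right; exists b.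
by left.
Qed.

Let union_sub_D n z : rudin_union n z -> exists m b, D m b z.
Proof.
elim: n => //= n IH [/IH //|[b _ Db]]; by exists n, b.
Qed.

(** If [b] is the first index with [z] in [C b] and [n] is large, then either an earlier layer
    contains [z], or [z] is itself a centre in layer [n]. *)
Let D_cover z : exists n b, D n b z.
Proof.
have [b [Cb lb]] := first_exists z.
have /nbhs_metricP [e [e0 eC]] : nbhs z (C b) by exact: open_nbhs_nbhs.
have [n ne] : exists n, rad n < e / 3 by apply: rad_lt; lra.
have [/union_sub_D //|nU] := pselect (rudin_union n z).
exists n, b, z; split=> //; last by rewrite dxx; exact: rad_gt0.
by move=> y zy; apply: eC; lra.
Qed.

(** Some [D n b] contains the ball of radius [rad j] around [z], and the centres of layers after [n]
    avoid it. As [k] exceeds [n] and [j], the ball of radius [rad k] therefore misses every layer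
    from [k] on. Within a layer [i] below [k], two points of that ball are closer than
    [2 * rad k <= rad i], too close for distinct indices. *)
Let D_locally_finite (z : Z) : exists (N : set Z) (k : nat), [/\ nbhs z N,
  (forall n b y, N y -> D n b y -> (n < k)%N) &
  (forall n b c y y', N y -> N y' -> D n b y -> D n c y' -> b = c)].
Proof.
have [n [b Db]] := D_cover z.
have /nbhs_metricP [e [e0 eD]] := open_nbhs_nbhs (conj (D_open n b) Db).
have [j je] := rad_lt e0.
pose k := (maxn n j).+1.
have kj : rad k <= rad j / 2.
  by rewrite /k radS; have := rad_le (leq_maxr n j); lra.
have layer_lt i c y : d z y < rad k -> D i c y -> (i < k)%N.
  move=> zy [x [_ nUx _ xy]]; rewrite ltnNge; apply/negP => ki.
  have ni : (n < i)%N by rewrite (leq_trans _ ki)// ltnS leq_maxl.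
  apply: nUx; apply: (D_sub_union ni (b := b)); apply: eD.
  have := dT y z x; have := dC x y; have := rad_le ki; lra.
exists [set y | d z y < rad k], k; split.
- exact/metric_ball_nbhs/rad_gt0.
- by move=> i c y; exact: layer_lt.
- move=> i b1 b2 y y' zy zy' D1 D2.
  have ik : rad k <= rad i / 2.
    by have := rad_le (layer_lt _ _ _ zy D1); rewrite radS; lra.
  have key c1 c2 p p' : d z p < rad k -> d z p' < rad k ->
      D i c1 p -> D i c2 p' -> le c2 c1.
    move=> zp zp' [x [_ _ inC xp]] [x' [[_ lx'] _ _ x'p']].
    apply: lx'; apply: inC.
    have := dT p x x'; have := dT z p x'; have := dT p' z x'.
    have := dC z p; have := dC x' p'; lra.
  have le_anti : antisymmetric le.
    have := wo_chain_antisymmetric (C := predT) (fun A _ => @le_wo A).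
    by move=> anti x x'; apply: anti.
  by apply: le_anti; rewrite (key b2 b1 y' y) ?(key b1 b2 y y').
Qed.

Lemma rudin_refinement : exists K : I * nat -> set Z,
  [/\ (forall j, closed (K j)), (forall j, K j `<=` C j.1),
      (forall z, exists j, K j z) &
      (forall z : Z, exists (N : set Z) (s : seq (I * nat)), nbhs z N /\
         forall j y, N y -> K j y -> j \in s)].
Proof.
exists (fun j => closure (D j.2 j.1)); split=> /=.
- by move=> j; exact: closed_closure.
- move=> [b n] z /= clz.
  (* A point of the closure is within [2 * rad n] of a centre, still inside the ball of radius
     [3 * rad n] that [C b] contains. *)
  have [w [[x [_ _ inC xw]] /= zw]] := clz _ (metric_ball_nbhs z (rad_gt0 n)).
  apply: inC; have := dT w x z; have := dC w z; have := rad_gt0 n; lra.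
- by move=> z; have [n [b Db]] := D_cover z; exists (b, n);
    exact: subset_closure.
- move=> z; have [N [k [Nz ltk uniqN]]] := D_locally_finite z.
  have [i0 _] := coverC z.
  pose T := [set j : I * nat | exists2 y, N y & D j.2 j.1 y].
  have /finite_seqP [s sE] : finite_set T.
    (* By [uniqN] each layer contributes at most one index to [T], so [T] lies in the image under
       [h] of the layers below [k]; [i0] is the default for layers that miss [N]. *)
    pose h n := (xget i0 [set b | T (b, n)], n).
    apply: sub_finite_set (finite_image h (finite_II k)) => -[b n] Tj.
    have [y Ny Dy] := Tj; exists n => /=; first exact: ltk Ny Dy.
    rewrite /h; congr pair.
    have [y' Ny' Dy'] : T (xget i0 [set b | T (b, n)], n).
      by apply: (@xgetPex _ i0 [set b | T (b, n)]); exists b.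
    exact: uniqN Ny' Ny Dy' Dy.
  (* Passing to the interior accounts for the closures: an open set meeting the closure of a [D n b]
     meets [D n b]. *)
  exists (interior N), s; split; first exact: nbhs_interior.
  move=> j y Ny clD; have [w [Dw Nw]] := clD _ Ny.
  by have : T j by [exists w]; rewrite sE.
Qed.

End refinement.
End metric.

Lemma metrizable_locally_finite_closed_refinement (Z : topologicalType)
    (I : choiceType) (C : I -> set Z) : metrizable Z ->
  (forall i, open (C i)) -> (forall z, exists i, C i z) ->
  exists K : I * nat -> set Z,
  [/\ (forall j, closed (K j)), (forall j, K j `<=` C j.1),
      (forall z, exists j, K j z) &
      (forall z : Z, exists (N : set Z) (s : seq (I * nat)), nbhs z N /\
         forall j y, N y -> K j y -> j \in s)].
Proof.
move=> [d dP] oC cC; have [le lewo] := well_ordering_principle I.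
exact: (rudin_refinement dP oC cC lewo).
Qed.

Lemma metrizable_closed_nbhs (Z : topologicalType) (A O : set Z) :
  metrizable Z -> closed A -> open O -> A `<=` O ->
  exists H, [/\ closed H, A `<=` interior H & H `<=` O].
Proof. by move=> [d dP]; exact: (metric_closed_nbhs dP). Qed.

(** * Hanner's theorem *)

(** Maps on a subset are encoded as total maps continuous within it, which avoids changing types
    when domains grow. The extension may take values outside [V]. *)
Definition nbhs_extendable (W : topologicalType) (V : set W) : Prop :=
  forall (Z : topologicalType), metrizable Z ->
  forall (A : set Z), closed A ->
  forall (f : Z -> W), {within A, continuous f} -> A `<=` f @^-1` V ->
  exists U, [/\ open U, A `<=` U & exists F : Z -> W,
    {within U, continuous F} /\ forall z, A z -> F z = f z].

Lemma ANE_extendable (W : topologicalType) : ANE W <-> nbhs_extendable [set: W].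
Proof.
split=> [aneW Z mZ A cA f cf _|extW Z mZ A cA f cf].
  have [|U [AU [F [cF Ff]]]] := aneW Z mZ A cA (sigL A f).
    exact/subspace_sigL_continuousP.
  exists (interior U); split=> //; first exact: open_interior.
  pose F' z := if pselect (U z) is left h then F (SigSub (mem_set h)) else f z.
  have FE z (Uz : U z) (h : z \in U) : F' z = F (SigSub h).
    by rewrite /F'; case: pselect => // h'; congr F; exact: val_inj.
  exists F'; split=> [|z Az].
    apply: (continuous_subspaceW (@interior_subset _ U)).
    apply/subspace_sigL_continuousP; rewrite (_ : sigL U F' = F)//.
    by apply/funext => -[z Uz]; rewrite /= (FE _ (set_mem Uz) Uz).
  have Uz := interior_subset (AU _ Az).
  by rewrite (FE _ Uz (mem_set Uz)) (Ff _ (SigSub (mem_set Az))).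
(* A total map extending [f] needs a default value in [W], taken from [f] at a point of [A]; for
   empty [A] the empty neighborhood suffices. *)
have [[a0 Aa0]|A0] := pselect (exists a, A a); last first.
  have abs (u : set_type (set0 : set Z)) : False := set_valP u.
  exists set0; split; first by move=> z Az; case: A0; exists z.
  by exists (fun u => False_rect W (abs u)); split=> u; case: (abs u).
pose w0 := f (SigSub (mem_set Aa0)).
have [|//|U [oU AU [F [cF Ff]]]] := extW Z mZ A cA (valL_ w0 f).
  exact/subspace_valL_continuousP'.
exists U; split; first by move=> z /AU Uz; exact: open_nbhs_nbhs.
exists (sigL U F); split; first exact/subspace_sigL_continuousP.
move=> u a ua; rewrite /sigL /= [_ u]ua Ff; last exact: set_valP.
by rewrite -[RHS](congr1 (fun g => g a) (valLK w0 f)).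
Qed.

(** * Maximal extensions along a locally finite closed cover *)

Section hanner.
Context (W Z : topologicalType) (I : choiceType) (V : I -> set W).
Context (oV : forall i, open (V i)) (extV : forall i, nbhs_extendable (V i)).
Context (mZ : metrizable Z) (A : set Z) (cA : closed A).
Context (f : Z -> W) (cf : {within A, continuous f}).
Context (J : eqType) (p : J -> I) (K : J -> set Z).
Context (cK : forall j, closed (K j)) (AK : forall j, A `&` K j `<=` f @^-1` V (p j)).
Context (coverK : forall z, exists j, K j z).
Context (lfK : forall z : Z, exists (N : set Z) (s : seq J), nbhs z N /\
   forall j y, N y -> K j y -> j \in s).

(** Near [z] only finitely many [K j] occur, and those not containing [z] are avoided because they
    are closed. *)
Let near_locally_finite (z : Z) (P : J -> Z -> Prop) :
  (forall j, K j z -> \forall y \near z, K j y -> P j y) ->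
  \forall y \near z, forall j, K j y -> P j y.
Proof.
move=> nearP; have [N [s [Nz Ns]]] := lfK z.
have {}nearP j : \forall y \near z, K j y -> P j y.
  have [/nearP //|nK] := pselect (K j z).
  have : nbhs z (~` K j) by apply: open_nbhs_nbhs; split=> //; exact: closed_openC.
  exact: filterS.
have : \forall y \near z, forall j, j \in s -> K j y -> P j y.
  elim: s {Ns} => [|j s IH]; first exact: nearW.
  apply: filterS2 (nearP j) IH => y Pj Ps i.
  by rewrite inE => /orP[/eqP -> //|]; exact: Ps.
by apply: filterS2 Nz => y Ny Ps j Kj; apply: Ps => //; exact: Ns Kj.
Qed.

(** [pe_idx] collects the indices already treated. [pe_compat] concerns all indices, so that the
    extension property of [V (p j)] applies whenever [j] comes to be treated. *)
Record partial_ext := PartialExt {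
  pe_idx : set J;
  pe_dom : set Z;
  pe_fun : Z -> W;
  pe_closed : closed pe_dom;
  pe_sub : A `<=` pe_dom;
  pe_cont : {within pe_dom, continuous pe_fun};
  pe_eq : forall z, A z -> pe_fun z = f z;
  pe_compat : forall j, pe_dom `&` K j `<=` pe_fun @^-1` V (p j);
  pe_nbhs : forall j a, pe_idx j -> A a -> K j a ->
    \forall z \near a, K j z -> pe_dom z }.

(* Each step adds points of the new [K j] only, so that by local finiteness
   the domains of a chain are locally stationary. *)
Definition pe_le (s t : partial_ext) : Prop :=
  [/\ pe_idx s `<=` pe_idx t, pe_dom s `<=` pe_dom t,
      (forall z, pe_dom s z -> pe_fun t z = pe_fun s z) &
      (forall z, pe_dom t z -> pe_dom s z \/
         exists j, [/\ pe_idx t j, ~ pe_idx s j & K j z])].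

Let pe_le_refl t : pe_le t t.
Proof. by split=> //; left. Qed.

Let pe_le_trans r s t : pe_le r s -> pe_le s t -> pe_le r t.
Proof.
move=> [i1 d1 f1 k1] [i2 d2 f2 k2]; split.
- exact: subset_trans i2.
- exact: subset_trans d2.
- by move=> z rz; rewrite f2 ?f1//; exact: d1.
- move=> z /k2 [/k1 [rz|[j [sj nrj Kj]]]|[j [tj nsj Kj]]]; first by left.
    by right; exists j; split=> //; exact: i2.
  by right; exists j; split=> // /i1.
Qed.

Let pe_base : partial_ext.
Proof. by apply: (@PartialExt set0 A f cA). Defined.

Section chain.
Context (Ch : set partial_ext) (totCh : total_on Ch pe_le).
Context (c0 : partial_ext) (Chc0 : Ch c0).

Let idx := \bigcup_(c in Ch) pe_idx c.
Let dom := \bigcup_(c in Ch) pe_dom c.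
(** By totality of the chain the value does not depend on the chosen member; [f z] is a default
    outside [dom]. *)
Let glue z :=
  if pselect (exists c, Ch c /\ pe_dom c z) is left h
  then pe_fun (projT1 (cid h)) z else f z.

Let glueE c z : Ch c -> pe_dom c z -> glue z = pe_fun c z.
Proof.
move=> Cc cz; rewrite /glue; case: pselect => [h|[]]; last by exists c.
case: cid => e /= [Ce ez].
by have [[_ _ -> //]|[_ _ -> //]] := totCh Cc Ce.
Qed.

Let idx_seq (s : seq J) : exists2 c, Ch c & forall j, j \in s -> idx j -> pe_idx c j.
Proof.
elim: s => [|i s [c Cc cs]]; first by exists c0.
have [[e Ce ei]|ni] := pselect (idx i); last first.
  exists c => // j; rewrite inE => /orP[/eqP -> //|]; exact: cs.
have [[ce _ _ _]|[ec _ _ _]] := totCh Cc Ce.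
  by exists e => // j; rewrite inE => /orP[/eqP -> //|js ij]; exact/ce/cs.
by exists c => // j; rewrite inE => /orP[/eqP -> _|]; [exact: ec|exact: cs].
Qed.

(** Near [z] only the finitely many indices of [s] occur. Some member [c] has treated all of those
    that the chain ever treats, so by the last clause of [pe_le] later members add no point near
    [z]. *)
Let dom_stationary (z : Z) :
  exists2 c, Ch c & \forall y \near z, dom y -> pe_dom c y.
Proof.
have [N [s [Nz Ns]]] := lfK z; have [c Cc cs] := idx_seq s.
exists c => //; apply: filterS Nz => y Ny [e Ce ey].
have [[_ _ _ /(_ _ ey) [//|[j [ej ncj Kj]]]]|[_ + _ _]] := totCh Cc Ce; last exact.
by case: ncj; apply: cs; [exact: Ns Kj|exists e].
Qed.

Let dom_closed : closed dom.
Proof.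
rewrite -[dom]setCK; apply: open_closedC; rewrite openE => z ndz.
have [c Cc cst] := dom_stationary z.
have : nbhs z (~` pe_dom c).
  apply: open_nbhs_nbhs; split; first exact: closed_openC (@pe_closed c).
  by move=> cz; apply: ndz; exists c.
by apply: filterS2 cst => y dc nc /dc.
Qed.

Let glue_cont : {within dom, continuous glue}.
Proof.
apply/subspace_continuousP => z dz O Oz.
have [c Cc cst] := dom_stationary z.
have cz : pe_dom c z := nbhs_singleton cst dz.
have {}Oz : nbhs (pe_fun c z) O by rewrite -(glueE Cc cz).
have /subspace_continuousP/(_ z cz O Oz) := @pe_cont c.
rewrite /nbhs /= /within /=.
apply: filterS2 cst => y dc Ocy dy.
by change (O (glue y)); rewrite (glueE Cc (dc dy)); exact/Ocy/dc.
Qed.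

Let pe_chain : partial_ext.
Proof.
apply: (@PartialExt idx dom glue) => //.
- by move=> z Az; exists c0 => //; exact: pe_sub.
- by move=> z Az; rewrite (glueE Chc0) ?pe_eq//; exact: pe_sub.
- by move=> j z [[c Cc cz] Kz]; rewrite /= (glueE Cc cz); exact: pe_compat.
- move=> j a [c Cc cj] Aa Ka; apply: filterS (pe_nbhs cj Aa Ka) => z cz /cz.
  by exists c.
Defined.

Lemma partial_ext_chain : exists t, forall s, Ch s -> pe_le s t.
Proof.
exists pe_chain => s Cs; split=> [j sj|z sz|z sz|z [e Ce ez]] /=.
- by exists s.
- by exists s.
- exact: glueE.
- have [[_ _ _ /(_ _ ez)]|[_ es _ _]] := totCh Cs Ce; last by left; exact: es.
  by move=> [|[j [ej nsj Kj]]]; [left|right; exists j; split=> //; exists e].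
Qed.

End chain.

(** By [pe_compat], [F] maps [B] [&] [K j] into [V (p j)], hence extends from there to a map [F1] on
    an open [O]. It is retained only on [H] [&] [K j], with [H] a closed neighborhood of [A] [&]
    [K j]; since [F1] agrees with [F] on [B] [&] [K j], the two glue along closed sets. *)
Lemma partial_ext_step (t : partial_ext) j :
  ~ pe_idx t j -> exists2 s, pe_le t s & pe_idx s j.
Proof.
move=> ntj; pose B := pe_dom t; pose F := pe_fun t.
have cL : closed (B `&` K j) by apply: closedI; [exact: pe_closed|exact: cK].
have [||O [oO LO [F1 [cF1 F1F]]]] := extV mZ cL (f := F) (i := p j).
- by apply: continuous_subspaceW (@pe_cont t); exact: subIsetl.
- exact: pe_compat.
(* [F1] may violate compatibility away from [B]; [M] is where it does not. Openness of the [V (p k)]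
   and local finiteness make [M] a neighborhood of each point of [A] [&] [K j]. *)
pose M : set Z := [set z | forall k, K k z -> V (p k) (F1 z)].
have AQ : A `&` K j `<=` interior (O `&` M).
  move=> a [Aa Ka]; have La : (B `&` K j) a by split=> //; exact: pe_sub.
  have Oa : nbhs a O by apply: open_nbhs_nbhs; split=> //; exact: LO.
  apply: filterI => //; apply: near_locally_finite => k Kka.
  have Va : nbhs (F1 a) (V (p k)).
    apply: open_nbhs_nbhs; split; first exact: oV.
    by rewrite F1F//; apply: (@pe_compat t); split=> //; exact: pe_sub.
  move: cF1; rewrite continuous_open_subspace// => /(_ a (mem_set (LO _ La))).
  move=> /(_ _ Va) VF1; apply: (@filterS _ (nbhs a) _ (F1 @^-1` V (p k))) => //.
have [H [cH AH HQ]] := metrizable_closed_nbhs mZ (closedI cA (@cK j))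
  (@open_interior _ (O `&` M)) AQ.
pose B' := B `|` (H `&` K j).
pose F' z := if pselect (B z) then F z else F1 z.
have F'F z : B z -> F' z = F z by rewrite /F'; case: pselect.
have F'F1 z : (H `&` K j) z -> F' z = F1 z.
  by move=> [_ Kz]; rewrite /F'; case: pselect => // Bz; rewrite F1F.
have HOM z : H z -> (O `&` M) z by move=> /HQ /interior_subset.
have cB : closed B := @pe_closed t.
have cHK : closed (H `&` K j) by exact: closedI.
have cF' : {within B', continuous F'}.
  apply: withinU_continuous => //.
    apply: subspace_eq_continuous (@pe_cont t) => z.
    by rewrite inE => /F'F.
  apply: (@subspace_eq_continuous _ _ _ F1).
    by move=> z; rewrite inE => /F'F1.
  by apply: continuous_subspaceW cF1 => z [/HOM []].
unshelve eexists (@PartialExt (pe_idx t `|` [set j]) B' F' _ _ _ _ _ _) => //.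
- exact: closedU.
- by move=> z Az; left; exact: (@pe_sub t).
- by move=> z Az; rewrite F'F ?[F z](@pe_eq t)//; exact: (@pe_sub t).
- move=> k z [[Bz|Hz] Kz] /=; first by rewrite F'F//; exact: (@pe_compat t).
  by rewrite F'F1//; apply: (HOM z _).2 => //; case: Hz.
- move=> k a [tk|->] Aa Ka.
    by apply: filterS (pe_nbhs tk Aa Ka) => z + /[dup] Kz => /[apply]; left.
  by apply: filterS (AH a (conj Aa Ka)) => z Hz Kz; right.
- split=> /=; [exact: subsetUl|exact: subsetUl|exact: F'F|].
  move=> z [Bz|[Hz Kz]]; [by left|right; exists j; split=> //; by right].
- by right.
Qed.

(** Zorn's lemma gives a maximal partial extension, which by [partial_ext_step] has treated every
    index. Its domain contains a neighborhood of [A] relative to each [K j], hence, by local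
    finiteness and covering, a neighborhood of [A]. *)
Lemma hanner_extension : exists U, [/\ open U, A `<=` U & exists F : Z -> W,
  {within U, continuous F} /\ forall z, A z -> F z = f z].
Proof.
have [t tmax] : exists t, premaximal pe_le t.
  have [|||t tmax] := @ZL_preorder _ pe_base (fun s t => `[< pe_le s t >]).
  - by move=> t; exact/asboolP.
  - by move=> r s t /asboolP rs /asboolP st; apply/asboolP; exact: pe_le_trans st.
  - move=> Ch tot; have {}tot : total_on Ch pe_le.
      by move=> s t Cs Ct; have [/asboolP|/asboolP] := tot s t Cs Ct; [left|right].
    have [[c Cc]|nC] := pselect (exists c, Ch c).
      have [t tub] := partial_ext_chain tot Cc.
      by exists t => s Cs; exact/asboolP/tub.
    by exists pe_base => s Cs; case: nC; exists s.
  by exists t => s /asboolP /tmax /asboolP.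
have allj j : pe_idx t j.
  apply: contrapT => nj; have [s ts sj] := partial_ext_step nj.
  by apply: nj; have [+ _ _ _] := tmax _ ts; exact.
exists (interior (pe_dom t)); split.
- exact: open_interior.
- move=> a Aa; have : \forall z \near a, forall j, K j z -> pe_dom t z.
    by apply: near_locally_finite => j Ka; exact: (pe_nbhs (allj j)).
  by apply: filterS => z Kz; have [j Kj] := coverK z; exact: Kz Kj.
- exists (pe_fun t); split; last exact: pe_eq.
  exact: continuous_subspaceW (@interior_subset _ _) (@pe_cont t).
Qed.

End hanner.

Lemma ANE_open_cover (W : topologicalType) (I : choiceType) (V : I -> set W) :
  (forall i, open (V i)) -> (forall w, exists i, V i w) ->
  (forall i, nbhs_extendable (V i)) -> ANE W.
Proof.
move=> oV cV extV; apply/ANE_extendable => Z mZ A cA f cf _.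
(* Points outside [A] belong to every [C i], which makes these sets open in [Z] itself and a cover
   of [Z]. *)
pose C i : set Z := [set z | A z -> V i (f z)].
have oC i : open (C i).
  rewrite openE => z Cz; have [Az|nAz] := pselect (A z).
    have /subspace_continuousP/(_ z Az (V i)) := cf; rewrite /nbhs/= /within/=.
    by apply; apply: open_nbhs_nbhs; split=> //; exact: Cz.
  have : nbhs z (~` A) by apply: open_nbhs_nbhs; split=> //; exact: closed_openC.
  by apply: filterS => y nAy /nAy.
have cC z : exists i, C i z by have [i Vi] := cV (f z); exists i.
have [K [cK KC cK' lfK]] := metrizable_locally_finite_closed_refinement mZ oC cC.
by apply: (hanner_extension oV extV mZ cA cf cK _ cK' lfK) => j z [Az /KC]; exact.
Qed.

(** * Open embeddings and retracts *)

Section open_embedding.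
Context (Y W : topologicalType) (j : Y -> W).
Context (cj : continuous j) (injj : injective j).
Context (oj : forall O, open O -> open (j @` O)).

Definition partial_inverse (y0 : Y) (w : W) : Y := xget y0 [set y | j y = w].

Let partial_inverseK y0 y : partial_inverse y0 (j y) = y.
Proof. by apply: injj; exact: (@xgetPex _ y0 [set x | j x = j y] (ex_intro _ y erefl)). Qed.

Let partial_inverse_continuous y0 : {in range j, continuous (partial_inverse y0)}.
Proof.
move=> w; rewrite inE => -[y _ <-] O; rewrite partial_inverseK nbhsE.
move=> [O' [oO' O'y] O'O].
have : nbhs (j y) (j @` O') by apply: open_nbhs_nbhs; split; [exact: oj|exists y].
apply: filterS => _ [x O'x <-]; apply: O'O.
by rewrite partial_inverseK.
Qed.

Lemma open_embedding_extendable : ANE Y -> nbhs_extendable (range j).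
Proof.
move=> /ANE_extendable extY Z mZ A cA f cf Aj.
have [[a0 Aa0]|A0] := pselect (exists a, A a); last first.
  exists set0; split; [exact: open0|by move=> a Aa; case: A0; exists a|].
  by exists f; split=> //; exact: continuous_subspace0.
have [y0 _ _] := Aj a0 Aa0.
have [|//|U [oU AU [F [cF Ff]]]] := extY Z mZ A cA (partial_inverse y0 \o f).
  apply: within_continuous_comp cf => w; rewrite inE => -[z Az <-].
  exact/partial_inverse_continuous/mem_set/Aj.
exists U; split=> //; exists (j \o F); split.
  by apply: within_continuous_comp cF => y _; exact: cj.
by move=> z Az; rewrite /= Ff//=; have [y _ <-] := Aj z Az; rewrite partial_inverseK.
Qed.

Lemma open_embedding_ANE : ANE W -> ANE Y.
Proof.
move=> /ANE_extendable extW; apply/ANE_extendable => Z mZ A cA f cf _.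
have [[a0 Aa0]|A0] := pselect (exists a, A a); last first.
  exists set0; split; [exact: open0|by move=> a Aa; case: A0; exists a|].
  by exists f; split=> //; exact: continuous_subspace0.
have [|//|U [oU AU [F [cF Ff]]]] := extW Z mZ A cA (j \o f).
  by apply: within_continuous_comp cf => y _; exact: cj.
(* [F] may leave the range of [j]; since that range is open, restricting to its preimage leaves an
   open neighborhood of [A]. *)
exists (U `&` F @^-1` range j); split.
- move: (cF); rewrite continuous_open_subspace// continuous_inP// => /(_ (range j)).
  by apply; apply: oj; exact: openT.
- by move=> z Az; split; [exact: AU|rewrite /= Ff//; exists (f z)].
- exists (partial_inverse (f a0) \o F); split.
    apply: within_continuous_comp.
      move=> w; rewrite inE => -[z [_ jz] <-].
      exact/partial_inverse_continuous/mem_set.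
    by apply: continuous_subspaceW cF; exact: subIsetl.
  by move=> z Az; rewrite /= Ff//= partial_inverseK.
Qed.

End open_embedding.

Lemma ANE_retract (Y W : topologicalType) (j : Y -> W) (r : W -> Y) :
  continuous j -> continuous r -> cancel j r -> ANE W -> ANE Y.
Proof.
move=> cj cr jK /ANE_extendable extW; apply/ANE_extendable => Z mZ A cA f cf _.
have [|//|U [oU AU [F [cF Ff]]]] := extW Z mZ A cA (j \o f).
  by apply: within_continuous_comp cf => y _; exact: cj.
exists U; split=> //; exists (r \o F); split.
  by apply: within_continuous_comp cF => y _; exact: cr.
by move=> z Az; rewrite /= Ff//= jK.
Qed.

(** * Enveloping spaces *)

Section enveloping.
Context (G Y : topologicalType) (mul : G -> G -> G) (inv : G -> G) (one : G).
Context (D : G -> set Y) (theta : G -> Y -> Y).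
Context (topG : topological_group mul inv one).
Context (nice : nice_partial_action mul inv one D theta).

Let mulA x y z : mul x (mul y z) = mul (mul x y) z.
Proof. by case: topG. Qed.
Let mul1g x : mul one x = x. Proof. by case: topG => _ /(_ x) []. Qed.
Let mulg1 x : mul x one = x. Proof. by case: topG => _ /(_ x) []. Qed.
Let mulVg x : mul (inv x) x = one. Proof. by case: topG => _ _ /(_ x) []. Qed.
Let mulgV x : mul x (inv x) = one. Proof. by case: topG => _ _ /(_ x) []. Qed.

Let inv_unique x y : mul x y = one -> y = inv x.
Proof. by move=> xy; rewrite -[y]mul1g -(mulVg x) -mulA xy mulg1. Qed.

Lemma group_invK x : inv (inv x) = x.
Proof. by rewrite -(inv_unique (mulVg x)). Qed.

Lemma group_inv1 : inv one = one.
Proof. by rewrite -(inv_unique (mul1g one)). Qed.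

Let inv_mulVg x y : inv (mul (inv x) y) = mul (inv y) x.
Proof.
by apply/esym/inv_unique; rewrite -mulA [mul y _]mulA mulgV mul1g mulVg.
Qed.

Let R := env_rel mul inv D theta.

(** In this form a single group element acts and the domain is that of its action, as in the axioms
    of a partial action. *)
Let env_relE (p q : G * Y) : R p q <->
  D (inv (mul (inv q.1) p.1)) p.2 /\ theta (mul (inv q.1) p.1) p.2 = q.2.
Proof. by rewrite inv_mulVg. Qed.

Let env_rel_refl p : R p p.
Proof.
case: nice => -[_ [D1 th1] _ _ _] _ _.
by apply/env_relE; rewrite mulVg group_inv1 D1 th1.
Qed.

Let env_rel_sym p q : R p q -> R q p.
Proof.
case: nice => -[_ _ thV _ _] _ _ /env_relE [Dp thp]; apply/env_relE.
by rewrite -inv_mulVg group_invK -thp; exact: thV.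
Qed.

Let env_rel_trans p q r : R p q -> R q r -> R p r.
Proof.
case: nice => -[_ _ _ _ thM] _ _ /env_relE [Dp thp] /env_relE [Dq thq].
apply/env_relE.
have <- : mul (mul (inv r.1) q.1) (mul (inv q.1) p.1) = mul (inv r.1) p.1.
  by rewrite -mulA [mul q.1 _]mulA mulgV mul1g.
by rewrite -thq -thp; apply: thM => //; rewrite thp.
Qed.

Lemma env_pi_eq p q : env_pi R p = env_pi R q <-> R p q.
Proof.
split=> [/(congr1 sval) /= pq|Rpq]; first by rewrite pq; exact: env_rel_refl.
apply: eq_exist; apply/seteqP; split=> r; last exact: env_rel_trans.
by move=> Rpr; apply: env_rel_trans Rpr; exact: env_rel_sym.
Qed.

(** The range of this map is the translate [g Y] inside the enveloping space. *)
Definition env_chart (g : G) (y : Y) : enveloping_space mul inv D theta :=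
  env_pi R (g, y).

Lemma env_chart_continuous g : continuous (env_chart g).
Proof.
apply/continuousP => U oU.
have cg : continuous (fun y : Y => (g, y)).
  by move=> y; apply: cvg_pair; [exact: cvg_cst|exact: cvg_id].
by move/continuousP : cg => /(_ _ oU).
Qed.

Lemma env_chart_inj g : injective (env_chart g).
Proof.
move=> x y /env_pi_eq/env_relE /= []; rewrite mulVg.
by case: nice => -[_ [_ th1] _ _ _] _ _; rewrite th1.
Qed.

(** The preimage of the image in [G * Y] consists of the [(h, y)] for which [theta (mul (inv g) h)]
    is defined at [y] with value in [O]. It is open by niceness, which gives an open domain and
    joint continuity of the action, and by continuity of [h] to [mul (inv g) h]. *)
Lemma env_chart_open g O : open O -> open (env_chart g @` O).
Proof.
move=> oO; case: nice => _ oS; rewrite continuous_open_subspace//.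
move=> /(continuous_inP _ oS)/(_ _ oO) oSO.
have cg : continuous (fun p : G * Y => (mul (inv g) p.1, p.2)).
  have [_ _ _ cmul _] := topG.
  move=> p; apply: cvg_pair; last exact: cvg_snd.
  apply: (@continuous_comp _ _ _ (fun p : G * Y => (inv g, p.1))
    (fun q : G * G => mul q.1 q.2)); last exact: cmul.
  by apply: cvg_pair; [exact: cvg_cst|exact: cvg_fst].
move/continuousP : cg => /(_ _ oSO); congr open; apply/seteqP; split=> -[h y] /=.
  move=> [Dy Oy]; exists (theta (mul (inv g) h) y) => //.
  by apply/env_pi_eq/env_rel_sym/env_relE.
by move=> [x Ox /env_pi_eq/env_rel_sym/env_relE /= [Dy thy]]; rewrite thy.
Qed.

Lemma ANE_enveloping_space : ANE Y <-> ANE (enveloping_space mul inv D theta).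
Proof.
split=> [aneY|]; last exact: (open_embedding_ANE (@env_chart_continuous one)
  (@env_chart_inj one) (@env_chart_open one)).
apply: (@ANE_open_cover _ G (fun g => range (env_chart g))) => g.
- exact/env_chart_open/openT.
- case: g => S [[g y] SE]; exists g, y => //.
  by apply: eq_exist.
- exact: (open_embedding_extendable (@env_chart_continuous g)
    (@env_chart_inj g) (@env_chart_open g)).
Qed.

End enveloping.

(** * Closed neighborhoods of points and products of metrizable spaces *)

Lemma metrizable_closed_nbhs1 (X : topologicalType) (x : X) (N : set X) :
  metrizable X -> nbhs x N -> exists H, [/\ closed H, nbhs x H & H `<=` N].
Proof.
rewrite {1}nbhsE => mX [O [oO Ox] ON].
have cx : closed [set x].
  rewrite -[[set x]]setCK; apply: open_closedC.
  have [d [d_ge0 d0 _ _ dopen]] := mX; apply/dopen => y yx.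
  exists (d y x); split.
    by have [//|/esym/d0] := Rle_lt_or_eq_dec _ _ (d_ge0 y x).
  by move=> z yz zx; move: yz; rewrite zx; exact: Rlt_irrefl.
have [_ ->//|H [cH xH HO]] := metrizable_closed_nbhs mX cx oO.
by exists H; split=> //; [exact: (xH x erefl)|exact: subset_trans ON].
Qed.

Lemma metrizable_prod (Z X : topologicalType) :
  metrizable Z -> metrizable X -> metrizable (Z * X)%type.
Proof.
move=> [dZ mZ] [dX mX].
have [Z0 Zeq ZC ZT _] := mZ; have [X0 Xeq XC XT _] := mX.
exists (fun p q => Rmax (dZ p.1 q.1) (dX p.2 q.2)); split.
- move=> p q; apply: Rle_trans (Rmax_l _ _); exact: Z0.
- move=> [z x] [z' x'] /=; split=> [m0|[<- <-]]; last first.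
    by rewrite (Zeq z z).2// (Xeq x x).2// Rmax_left//; exact: Rle_refl.
  have := Rmax_l (dZ z z') (dX x x'); have := Rmax_r (dZ z z') (dX x x').
  rewrite m0 => x0 z0; congr pair; first apply/Zeq; last apply/Xeq.
    exact: Rle_antisym.
  exact: Rle_antisym.
- by move=> p q; rewrite ZC XC.
- move=> p q r; apply: Rmax_lub.
    have := ZT p.1 q.1 r.1; have := Rmax_l (dZ p.1 q.1) (dX p.2 q.2).
    have := Rmax_l (dZ q.1 r.1) (dX q.2 r.2); lra.
  have := XT p.2 q.2 r.2; have := Rmax_r (dZ p.1 q.1) (dX p.2 q.2).
  have := Rmax_r (dZ q.1 r.1) (dX q.2 r.2); lra.
- move=> U; split.
    rewrite openE => oU [z x] /oU [[P Q] /= [Pz Qx] PQU].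
    have [e [e0 eP]] := (nbhs_metricP mZ _ _).1 Pz.
    have [e' [e'0 e'Q]] := (nbhs_metricP mX _ _).1 Qx.
    exists (Rmin e e'); split; first exact: Rmin_glb_lt.
    move=> [z' x'] /= lte; apply: PQU; split=> /=; [apply: eP|apply: e'Q].
      have := Rmax_l (dZ z z') (dX x x'); have := Rmin_l e e'; lra.
    have := Rmax_r (dZ z z') (dX x x'); have := Rmin_r e e'; lra.
  move=> ballU; rewrite openE => -[z x] /ballU [e [e0 eU]].
  exists ([set z' | Rlt (dZ z z') e], [set x' | Rlt (dX x x') e]) => /=.
    by split; exact: metric_ball_nbhs.
  by move=> [z' x'] /= [ze xe]; apply: eU; exact: Rmax_lub_lt.
Qed.

(** * Function spaces *)

Section function_space.
Context (X : topologicalType) (cptX : compact [set: X]) (mX : metrizable X).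

(** Compact-open convergence is continuous convergence here. Forwards, a closed, hence compact,
    neighborhood [H] of [x0] inside the preimage of [O'] gives a subbasic open set; backwards,
    compactness of [K] makes the local conditions uniform. *)
Lemma CXY_cvgP (Y : topologicalType) (T : Type) (F : set_system T)
    (f : T -> CXY X Y) (f0 : CXY X Y) : Filter F ->
  f @ F --> f0 <->
  forall x0 (O : set Y), nbhs ((val f0 : X -> Y) x0) O ->
    \forall x \near x0 & t \near F, O ((val (f t) : X -> Y) x).
Proof.
move=> FF; split=> [ff0 x0 O|ev].
  rewrite nbhsE => -[O' [oO' O'x0] O'O].
  have cf0 : continuous (val f0 : X -> Y) by exact: (set_valP f0).
  have [|H [cH Hx0 HO]] := @metrizable_closed_nbhs1 X x0 (val f0 @^-1` O') mX.
    by apply: cf0; exact: open_nbhs_nbhs.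
  have cptH : compact H by rewrite -[H]setTI; exact: compact_closedI.
  have : nbhs f0 (val @^-1` [set g : {compact-open, X -> Y} | g @` H `<=` O']).
    apply: open_nbhs_nbhs; split; last by move=> _ [x Hx <-]; exact: HO.
    by eexists; [exact: compact_open_open cptH oO'|].
  move=> /ff0 Ff; exists (H, f @^-1` (val @^-1` [set g : {compact-open, X -> Y} | g @` H `<=` O'])) => //.
  by move=> [x t] /= [Hx ft]; apply: O'O; apply: ft; exists x.
move=> B [_ [[O oO <-] /= Of0 OB]].
suff : (val \o f) @ F --> (val f0 : {compact-open, X -> Y}).
  move=> /(_ O (open_nbhs_nbhs (conj oO Of0))); rewrite /= /nbhs /=.
  by apply: filterS => t /= Oft; exact: OB.
apply/compact_open_cvgP => K O' cptK oO' f0K.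
suff : \near F, K `<=` (fun x => O' ((val (f F) : X -> Y) x)).
  by apply: filterS => t Kt _ [x Kx <-]; exact: Kt.
move/compact_near_coveringP : cptK; apply=> x Kx.
by apply: ev; apply: open_nbhs_nbhs; split=> //; apply: f0K; exists x.
Qed.

Definition CXY_of (Y : topologicalType) (h : X -> Y) (ch : continuous h) :
  CXY X Y := @SigSub _ _ [set f : {compact-open, X -> Y} | continuous (f : X -> Y)]
    h (mem_set ch).

Lemma ANE_CXY_codomain (Y : topologicalType) (x0 : X) : ANE (CXY X Y) -> ANE Y.
Proof.
apply: (@ANE_retract _ _ (fun y => CXY_of (@cst_continuous X Y y))
  (fun f => (val f : X -> Y) x0)) => // [y|f].
  apply/CXY_cvgP => x O /= Oy.
  by exists (setT, O) => [|[? ?] [] //]; split=> //; exact: filterT.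
move=> O Of.
have /CXY_cvgP/(_ x0 O Of) [[A B] /= [Ax Bf] AB] : id @ nbhs f --> f by exact: cvg_id.
by apply: filterS Bf => g Bg; apply: (AB (x0, g)); split=> //; exact: nbhs_singleton.
Qed.

Lemma ANE_CXY (Y : topologicalType) : ANE Y -> ANE (CXY X Y).
Proof.
move=> /ANE_extendable extY; apply/ANE_extendable => Z mZ A cA f cf _.
pose h (p : Z * X) := (val (f p.1) : X -> Y) p.2.
have cAX : closed (fst @^-1` A : set (Z * X)).
  by apply: preimage_closed cA => p _; exact: cvg_fst.
have [|//|U [oU AU [H [cH Hh]]]] := extY _ (metrizable_prod mZ mX) _ cAX h.
  apply/subspace_continuousP => -[z x] /= Az O Oh.
  have /subspace_continuousP/(_ z Az)/CXY_cvgP/(_ x O Oh) := cf.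
  move=> [[P Q] /= [Px Qz] PQ]; exists ([set z' | A z' -> Q z'], P) => //= -[z' x'] /= [Qz' Px'] Az'.
  by apply: (PQ (x', z')); split=> //; exact: Qz'.
have {}cH p : U p -> {for p, continuous H}.
  by move: cH; rewrite continuous_open_subspace// => cH Up; apply: cH; rewrite inE.
(* The tube lemma: compactness of [X] makes [U'] open. Over [U'] the extension is the curried [H];
   elsewhere [F] takes [f z] as a default. *)
pose U' : set Z := [set z | forall x, U (z, x)].
have oU' : open U'.
  rewrite openE => z Uz.
  suff : \near z, [set: X] `<=` (fun x => U (z, x)).
    by apply: filterS => z' Uz' x; exact: Uz'.
  move/compact_near_coveringP : cptX; apply=> x _.
  have [[P Q] /= [Pz Qx] PQ] := open_nbhs_nbhs (conj oU (Uz x)).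
  by exists (Q, P) => //= -[x' z'] /= [Qx' Pz']; exact: (PQ (z', x')).
have cHz z : U' z -> continuous (fun x => H (z, x)).
  move=> Uz x; apply: (@continuous_comp _ _ _ (fun x => (z, x)) H).
    by apply: cvg_pair; [exact: cvg_cst|exact: cvg_id].
  exact: cH.
pose F z : CXY X Y := if pselect (U' z) is left h then CXY_of (cHz z h) else f z.
have FE z x : U' z -> (val (F z) : X -> Y) x = H (z, x).
  by move=> Uz; rewrite /F; case: pselect.
exists U'; split=> //; first by move=> z Az x; exact: AU.
exists F; split=> [|z Az].
  rewrite continuous_open_subspace// => z; rewrite inE => Uz.
  apply/CXY_cvgP => x O; rewrite FE// => /(cH _ (Uz x)) [[P Q] /= [Pz Qx] PQ].
  exists (Q, P `&` U') => /=.
    by split=> //; apply: filterI => //; exact: open_nbhs_nbhs.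
  by move=> [x' z'] /= [Qx' [Pz' Uz']]; rewrite FE//; exact: (PQ (z', x')).
apply: val_inj; apply/funext => x; rewrite FE; last by move=> x'; exact: AU.
exact: Hh.
Qed.

(** * The induced partial action is nice *)

Section hat_action.
Context (G Y : topologicalType) (mul : G -> G -> G) (inv : G -> G) (one : G).
Context (D : G -> set Y) (theta : G -> Y -> Y).
Context (topG : topological_group mul inv one).
Context (nice : nice_partial_action mul inv one D theta).

Let hatD : G -> set (CXY X Y) := hat_dom D.
Let hat : G -> CXY X Y -> CXY X Y := hat_act theta.
Let S : set (G * Y) := [set p | D (inv p.1) p.2].

Let oS : open S. Proof. by case: nice. Qed.

Let theta_cont p : S p -> {for p, continuous (fun q : G * Y => theta q.1 q.2)}.
Proof.
case: nice => _ _ + Sp; rewrite continuous_open_subspace// => ct.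
by apply: ct; rewrite inE.
Qed.

(** All values of [f] lie in the open domain of [theta g], so the composite is continuous and
    [hat_act] takes its first branch. *)
Lemma hat_actE g (f : CXY X Y) x : hatD (inv g) f ->
  (val (hat g f) : X -> Y) x = theta g ((val f : X -> Y) x).
Proof.
move=> Df; rewrite /hat /hat_act; case: pselect => // -[] y.
have cf : continuous (val f : X -> Y) by exact: (set_valP f).
apply: (@continuous_comp _ _ _ (val f : X -> Y) (theta g)); first exact: cf.
apply: (@continuous_comp _ _ _ (fun y => (g, y)) (fun q : G * Y => theta q.1 q.2)).
  by apply: cvg_pair; [exact: cvg_cst|exact: cvg_id].
by apply: theta_cont; exact: Df.
Qed.

Let E : set (G * CXY X Y) := [set p | hatD (inv p.1) p.2].

(* Evaluation is jointly continuous since [X] is compact and regular. *)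
Let near_eval (p0 : G * CXY X Y) x (O : set (G * Y)) :
  nbhs (p0.1, (val p0.2 : X -> Y) x) O ->
  \forall x' \near x & p \near p0, O (p.1, (val p.2 : X -> Y) x').
Proof.
move=> [[P Q] /= [Pg Qf] PQ].
have /CXY_cvgP/(_ x Q Qf) [[A B] /= [Ax Bp] AB] :
  snd @ nbhs p0 --> p0.2 by exact: cvg_snd.
exists (A, B `&` fst @^-1` P) => /=.
  by split=> //; apply: filterI => //; exact: (@cvg_fst _ _ _ _ _ P).
move=> [x' p] /= [Ax' [Bp' Pp]]; apply: PQ; split=> //=.
exact: (AB (x', p)).
Qed.

(** Again the tube lemma: by [near_eval] the open condition [S] persists near each [x], and
    compactness of [X] makes it uniform in [x]. *)
Let oE : open E.
Proof.
rewrite openE => p0 Ep0.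
suff : \near p0, [set: X] `<=` (fun x => S (p0.1, (val p0.2 : X -> Y) x)).
  by apply: filterS => p Sp x; exact: Sp.
move/compact_near_coveringP : cptX => /(_ _ (nbhs p0)
  (fun p x => S (p.1, (val p.2 : X -> Y) x))); apply=> x _; apply: near_eval.
by apply: open_nbhs_nbhs; split=> //; exact: Ep0.
Qed.

Let hat_cont p : E p -> {for p, continuous (fun q : G * CXY X Y => hat q.1 q.2)}.
Proof.
move=> Ep; apply/CXY_cvgP => x O; rewrite hat_actE// => Oth.
have : nbhs (p.1, (val p.2 : X -> Y) x) ((fun q : G * Y => theta q.1 q.2) @^-1` O).
  exact: (theta_cont (p := (p.1, (val p.2 : X -> Y) x)) (Ep x) Oth).
move=> /near_eval [[A B] /= [Ax Bp] AB].
(* Nearby pairs are kept inside [E], where [hat] is composition with [theta]. *)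
have nE : nbhs p E by apply: open_nbhs_nbhs; split=> //; exact: oE.
exists (A, B `&` E); first by split=> //; exact: filterI.
by move=> [x' q] /= [Ax' [Bq Eq]]; rewrite hat_actE//; exact: (AB (x', q)).
Qed.

Lemma hat_nice : nice_partial_action mul inv one hatD hat.
Proof.
have [[oD [D1 th1] thV _ thM] _ _] := nice.
have pair_cont (g : G) : continuous (fun f : CXY X Y => (g, f)).
  move=> f O [[P Q] /= [Pg Qf] PQ]; apply: filterS Qf => f' Qf'.
  by apply: (PQ (g, f')); split=> //; exact: nbhs_singleton.
(* Each such domain is the slice of the open set [E] at [g]. *)
have oD' g : open (hatD (inv g)).
  by have /continuousP/(_ _ oE) := pair_cont g.
split=> //; last first.
  by rewrite continuous_open_subspace// => p; rewrite inE; exact: hat_cont.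
split=> [g||g f Df|g|g h f Dh Dg].
- by rewrite -(group_invK topG g).
- have DT : hatD one = setT.
    by apply/seteqP; split=> // f _ x; rewrite D1.
  split=> // f; apply: val_inj; apply/funext => x.
  by rewrite hat_actE ?th1// (group_inv1 topG) DT.
- have DVf : hatD g (hat g f).
    by move=> x; rewrite hat_actE//; exact: (thV g _ (Df x)).1.
  split=> //; apply: val_inj; apply/funext => x.
  rewrite hat_actE ?(group_invK topG)// hat_actE//.
  exact: (thV g _ (Df x)).2.
- rewrite continuous_open_subspace// => f; rewrite inE => Df.
  exact: (continuous_comp (@pair_cont g f) (@hat_cont (g, f) Df)).
- have M x : D (inv g) (theta h ((val f : X -> Y) x)).
    by rewrite -hat_actE//; exact: Dg.
  have Dgh : hatD (inv (mul g h)) f by move=> x; exact: (thM _ _ _ (Dh x) (M x)).1.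
  split=> //; apply: val_inj; apply/funext => x; rewrite !hat_actE//.
  exact: (thM _ _ _ (Dh x) (M x)).2.
Qed.

End hat_action.
End function_space.

Theorem theorem3p16 (G Y X : topologicalType)
    (mul : G -> G -> G) (inv : G -> G) (one : G)
    (D : G -> set Y) (theta : G -> Y -> Y) :
  topological_group mul inv one -> hausdorff_space G ->
  nice_partial_action mul inv one D theta ->
  (exists x : X, True) -> compact [set: X] -> metrizable X ->
  [/\ (ANE Y <-> ANE (enveloping_space mul inv D theta)),
      (ANE (enveloping_space mul inv D theta) <->
       ANE (enveloping_space mul inv (@hat_dom G X Y D) (@hat_act G X Y theta))) &
      (ANE (enveloping_space mul inv (@hat_dom G X Y D) (@hat_act G X Y theta)) <->
       ANE (CXY X Y))].
Proof.
move=> topG _ nice [x0 _] cptX mX.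
have envY := ANE_enveloping_space topG nice.
have envC := ANE_enveloping_space topG (hat_nice cptX mX topG nice).
have CY : ANE Y <-> ANE (CXY X Y).
  by split; [exact: ANE_CXY|exact: ANE_CXY_codomain].
split=> //; last exact: iff_sym.
exact: iff_trans (iff_sym envY) (iff_trans CY envC).
Qed.
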